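(* There exists a recursive coloring function $c:\mathbb{N}\rightarrow \{0,1\}^3$ such that no infinite $\Delta^0_3$ set $A\subseteq\mathbb{N}$ is a solution to $c$ for $\mathrm{HT}^{\leq 3}$, i.e. for every infinite $\Delta^0_3$ set $A$, the set $FS^{\leq 3}(A)$ is not monochromatic under $c$.
   Context: For a set $H\subseteq\mathbb{N}$ and a natural number $k$, $FS^{\leq k}(H)=\{\sum_{x\in F}x : F\subseteq H,\ F\text{ nonempty},\ |F|\leq k\}$. A set $H$ is a solution to $c$ for $\mathrm{HT}^{\leq k}$ if $H$ is infinite and $FS^{\leq k}(H)$ is monochromatic under $c$. *)

(* Defs.v *)
From mathcomp Require Import all_boot.
Set Implicit Arguments. Unset Strict Implicit. Unset Printing Implicit Defensive.

Inductive code : Type :=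
| CZero
| CSucc
| CProj (i : nat)                    (* i-th argument (0 if absent) *)
| CComp (f : code) (gs : seq code)
| CPrec (f g : code)
| CMu (f : code).

Inductive eval : code -> seq nat -> nat -> Prop :=
| eZero xs : eval CZero xs 0
| eSucc xs : eval CSucc xs (head 0 xs).+1
| eProj i xs : eval (CProj i) xs (nth 0 xs i)
| eComp f gs xs ys y :
    evals gs xs ys -> eval f ys y -> eval (CComp f gs) xs y
| ePrec0 f g xs y : eval f xs y -> eval (CPrec f g) (0 :: xs) y
| ePrecS f g n xs r y :
    eval (CPrec f g) (n :: xs) r -> eval g (n :: r :: xs) y ->
    eval (CPrec f g) (n.+1 :: xs) y
| eMu f xs n :
    eval f (n :: xs) 0 ->
    (forall m, m < n -> exists k, eval f (m :: xs) k.+1) ->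
    eval (CMu f) xs n
with evals : seq code -> seq nat -> seq nat -> Prop :=
| esNil xs : evals [::] xs [::]
| esCons g gs xs y ys :
    eval g xs y -> evals gs xs ys -> evals (g :: gs) xs (y :: ys).

Definition recursive1 (f : nat -> nat) : Prop :=
  exists e, forall n, eval e [:: n] (f n).

Definition recursive_rel4 (R : nat -> nat -> nat -> nat -> bool) : Prop :=
  exists e, forall x a b c, eval e [:: x; a; b; c] (nat_of_bool (R x a b c)).

Definition Sigma03 (A : nat -> Prop) : Prop :=
  exists R, recursive_rel4 R /\
    forall x, A x <-> exists a, forall b, exists c, R x a b c.

Definition Delta03 (A : nat -> Prop) : Prop :=
  Sigma03 A /\ Sigma03 (fun x => ~ A x).

Definition colour3 := (bool * bool * bool)%type.

Definition colour_code (b : colour3) : nat :=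
  let: (b1, b2, b3) := b in 4 * b1 + 2 * b2 + b3.

Definition recursive_coloring (c : nat -> colour3) : Prop :=
  recursive1 (fun n => colour_code (c n)).

Definition FSle (k : nat) (H : nat -> Prop) (n : nat) : Prop :=
  exists F : seq nat,
    [/\ uniq F, (forall x, x \in F -> H x), 0 < size F, size F <= k
      & n = sumn F].

Definition infinite_set (H : nat -> Prop) : Prop :=
  forall m, exists n, m <= n /\ H n.

Definition HT_solution (k : nat) (c : nat -> colour3) (H : nat -> Prop) : Prop :=
  infinite_set H /\ exists col, forall n, FSle k H n -> c n = col.

(* Main.v *)
Require Import Defs.
From mathcomp Require Import all_boot.
From mathcomp Require Import zify.
From Stdlib Require Import Classical.

Set Implicit Arguments.
Unset Strict Implicit.
Unset Printing Implicit Defensive.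

(** Write numbers in base 3.  One bit of the colour of [n] is its lowest nonzero
    digit: two members of a solution [A] with the same 3-adic valuation have a
    sum of the other colour, so members of [A] are eventually divisible by any
    given power of 3.

    The second bit is [parity n], the sum modulo 2 of [chi j (hi j n)] over the
    nonzero digits [j] of [n], where [hi j n] is the part of [n] above digit [j].
    Adding a small [x] below a very divisible [u] only adds terms for the digits
    of [x], and the freedom in [chi (log3 x) u], the term of the leading digit of
    [x], can be used to force [parity (x + u) <> parity u].  This is done for
    elements [x] guessed from [u] to lie in [A]: if [A] is the [e]-th Sigma^0_3
    set, take [u = y + z] with [y] and then [z] in [A] large enough; the universal
    quantifier is tested up to the valuation of [y] and the innermost existential
    one up to [u], so the guess made by the [e]-th requirement is correct, and
    [x + y + z] and [y + z] are coloured differently.  Requirement [e] proposes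
    [2 ^ e] elements with distinct leading positions, hence at least one of them
    escapes the requirements of smaller index. *)

(** * Closure properties of recursive functions *)

(* [f : X -> nat] is recursive when [x] is presented by the values [p x], for [p] in [ps]. *)
Definition Rec (X : Type) (ps : seq (X -> nat)) (f : X -> nat) : Prop :=
  exists e, forall x, eval e [seq p x | p <- ps] (f x).

Definition rec1 (h : nat -> nat) := Rec [:: id] h.
Definition rec2 (h : nat -> nat -> nat) :=
  @Rec (nat * nat) [:: fst; snd] (fun x => h x.1 x.2).
Definition rec3 (h : nat -> nat -> nat -> nat) :=
  @Rec (nat * nat * nat) [:: (fun x => x.1.1); (fun x => x.1.2); snd]
    (fun x => h x.1.1 x.1.2 x.2).
Definition rec4 (h : nat -> nat -> nat -> nat -> nat) :=
  @Rec (nat * nat * nat * nat)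
    [:: (fun x => x.1.1.1); (fun x => x.1.1.2); (fun x => x.1.2); snd]
    (fun x => h x.1.1.1 x.1.1.2 x.1.2 x.2).
Definition rec5 (h : nat -> nat -> nat -> nat -> nat -> nat) :=
  @Rec (nat * nat * nat * nat * nat)
    [:: (fun x => x.1.1.1.1); (fun x => x.1.1.1.2); (fun x => x.1.1.2);
        (fun x => x.1.2); snd]
    (fun x => h x.1.1.1.1 x.1.1.1.2 x.1.1.2 x.1.2 x.2).

Section Closure.
Variables (X : Type) (ps : seq (X -> nat)).
Implicit Types f g : X -> nat.

Lemma Rec_ext f g : f =1 g -> Rec ps f -> Rec ps g.
Proof. by move=> fg [e He]; exists e => x; rewrite -fg. Qed.

Lemma Rec_app1 h f : rec1 h -> Rec ps f -> Rec ps (fun x => h (f x)).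
Proof.
move=> [e He] [ef Hf]; exists (CComp e [:: ef]) => x.
apply: (eComp _ (He (f x))); repeat (apply: esCons => //); apply: esNil.
Qed.

Lemma Rec_app2 h f1 f2 : rec2 h -> Rec ps f1 -> Rec ps f2 ->
  Rec ps (fun x => h (f1 x) (f2 x)).
Proof.
move=> [e He] [e1 H1] [e2 H2]; exists (CComp e [:: e1; e2]) => x.
apply: (eComp _ (He (f1 x, f2 x))); repeat (apply: esCons => //); apply: esNil.
Qed.

Lemma Rec_app3 h f1 f2 f3 : rec3 h -> Rec ps f1 -> Rec ps f2 -> Rec ps f3 ->
  Rec ps (fun x => h (f1 x) (f2 x) (f3 x)).
Proof.
move=> [e He] [e1 H1] [e2 H2] [e3 H3]; exists (CComp e [:: e1; e2; e3]) => x.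
apply: (eComp _ (He (f1 x, f2 x, f3 x)));
  repeat (apply: esCons => //); apply: esNil.
Qed.

Lemma Rec_app4 h f1 f2 f3 f4 : rec4 h ->
  Rec ps f1 -> Rec ps f2 -> Rec ps f3 -> Rec ps f4 ->
  Rec ps (fun x => h (f1 x) (f2 x) (f3 x) (f4 x)).
Proof.
move=> [e He] [e1 H1] [e2 H2] [e3 H3] [e4 H4].
exists (CComp e [:: e1; e2; e3; e4]) => x.
apply: (eComp _ (He (f1 x, f2 x, f3 x, f4 x)));
  repeat (apply: esCons => //); apply: esNil.
Qed.

Lemma Rec_app5 h f1 f2 f3 f4 f5 : rec5 h ->
  Rec ps f1 -> Rec ps f2 -> Rec ps f3 -> Rec ps f4 -> Rec ps f5 ->
  Rec ps (fun x => h (f1 x) (f2 x) (f3 x) (f4 x) (f5 x)).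
Proof.
move=> [e He] [e1 H1] [e2 H2] [e3 H3] [e4 H4] [e5 H5].
exists (CComp e [:: e1; e2; e3; e4; e5]) => x.
apply: (eComp _ (He (f1 x, f2 x, f3 x, f4 x, f5 x)));
  repeat (apply: esCons => //); apply: esNil.
Qed.

Lemma rec_succ : rec1 S.
Proof. by exists CSucc => x; apply: (eSucc [:: x]). Qed.

Lemma Rec_const n : Rec ps (fun=> n).
Proof.
elim: n => [|n IHn]; first by exists CZero => x; apply: eZero.
exact: (Rec_app1 rec_succ IHn).
Qed.

Lemma evals_proj (xs : seq nat) : evals [seq CProj i | i <- iota 0 (size xs)] xs xs.
Proof.
suff H k : k <= size xs ->
    evals [seq CProj i | i <- iota (size xs - k) k] xs (drop (size xs - k) xs).
  by have := H (size xs) (leqnn _); rewrite subnn drop0.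
elim: k => [|k IHk] lek; first by rewrite subn0 drop_size; apply: esNil.
have lt : size xs - k.+1 < size xs by lia.
rewrite (drop_nth 0 lt) /=; apply: esCons; first exact: eProj.
have -> : (size xs - k.+1).+1 = size xs - k by lia.
exact/IHk/ltnW.
Qed.

Lemma Rec_iteri N f (F : nat -> nat -> X -> nat) :
  Rec ps N -> Rec ps f ->
  @Rec (nat * nat * X)
    [:: (fun y => y.1.1), (fun y => y.1.2) & [seq (fun y => p y.2) | p <- ps]]
    (fun y => F y.1.1 y.1.2 y.2) ->
  Rec ps (fun x => iteri (N x) (fun i r => F i r x) (f x)).
Proof.
move=> [eN HN] [ef Hf] [eF HF].
exists (CComp (CPrec ef eF) (eN :: [seq CProj i | i <- iota 0 (size ps)])) => x.
apply: (eComp (ys := N x :: [seq p x | p <- ps])).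
  by apply: esCons => //; have := evals_proj [seq p x | p <- ps]; rewrite size_map.
elim: (N x) => [|n IHn]; first by apply: ePrec0; apply: Hf.
apply: ePrecS; first exact: IHn.
by have := HF (n, iteri n (fun i r => F i r x) (f x), x); rewrite /= -map_comp.
Qed.

End Closure.

(* Proof search for recursiveness *)
#[local] Hint Resolve rec_succ : rec.

Ltac rec_proj := first
  [ exists (CProj 0); let x := fresh in intro x; exact (eProj 0 _)
  | exists (CProj 1); let x := fresh in intro x; exact (eProj 1 _)
  | exists (CProj 2); let x := fresh in intro x; exact (eProj 2 _)
  | exists (CProj 3); let x := fresh in intro x; exact (eProj 3 _)
  | exists (CProj 4); let x := fresh in intro x; exact (eProj 4 _)
  | exists (CProj 5); let x := fresh in intro x; exact (eProj 5 _)
  | exists (CProj 6); let x := fresh in intro x; exact (eProj 6 _)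
  | exists (CProj 7); let x := fresh in intro x; exact (eProj 7 _)
  | exists (CProj 8); let x := fresh in intro x; exact (eProj 8 _)].

Ltac rec_known := solve [auto with rec nocore].

(** Placeholders, redefined once closure under connectives, bounded quantifiers, bounded search and
    conditionals is available. *)
Ltac rec_struct := fail.
Ltac rec_cond := fail.

Ltac rec_app := match goal with
  | |- Rec _ (fun x => nat_of_bool (?h (@?f x) (@?g x) (@?k x) (@?l x) (@?m x))) =>
     apply: (@Rec_app5 _ _ (fun a b c d e => nat_of_bool (h a b c d e)) f g k l m); first rec_known
  | |- Rec _ (fun x => nat_of_bool (?h (@?f x) (@?g x) (@?k x) (@?l x))) =>
     apply: (@Rec_app4 _ _ (fun a b c d => nat_of_bool (h a b c d)) f g k l); first rec_known
  | |- Rec _ (fun x => nat_of_bool (?h (@?f x) (@?g x) (@?k x))) =>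
     apply: (@Rec_app3 _ _ (fun a b c => nat_of_bool (h a b c)) f g k); first rec_known
  | |- Rec _ (fun x => nat_of_bool (?h (@?f x) (@?g x))) =>
     apply: (@Rec_app2 _ _ (fun a b => nat_of_bool (h a b)) f g); first rec_known
  | |- Rec _ (fun x => nat_of_bool (?h (@?f x))) =>
     apply: (@Rec_app1 _ _ (fun a => nat_of_bool (h a)) f); first rec_known
  | |- Rec _ (fun x => ?h (@?f x) (@?g x) (@?k x) (@?l x) (@?m x)) =>
     apply: (@Rec_app5 _ _ h f g k l m); first rec_known
  | |- Rec _ (fun x => ?h (@?f x) (@?g x) (@?k x) (@?l x)) =>
     apply: (@Rec_app4 _ _ h f g k l); first rec_known
  | |- Rec _ (fun x => ?h (@?f x) (@?g x) (@?k x)) =>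
     apply: (@Rec_app3 _ _ h f g k); first rec_known
  | |- Rec _ (fun x => ?h (@?f x) (@?g x)) =>
     apply: (@Rec_app2 _ _ h f g); first rec_known
  | |- Rec _ (fun x => ?h (@?f x)) =>
     apply: (@Rec_app1 _ _ h f); first rec_known
  | |- Rec _ ?h => apply: (@Rec_app1 _ _ h (fun x => x)); first rec_known
  end.

Ltac rec_step := cbv beta; first
  [ apply: Rec_const | rec_proj | rec_struct | rec_app
  | apply: Rec_iteri
  | lazymatch goal with |- Rec _ (fun x => nat_of_bool _) => fail | _ => rec_cond end ].
Ltac rec := rewrite /rec1 /rec2 /rec3 /rec4 /rec5; repeat rec_step.

(** * Recursive arithmetic and bounded operators *)

Lemma rec_add : rec2 addn.
Proof.
apply: (@Rec_ext _ _ (fun x => iteri x.2 (fun i r => r.+1) x.1)); last by rec.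
by move=> [a b] /=; elim: b => [|b /= ->] /=; rewrite ?addn0 ?addnS.
Qed.
#[local] Hint Resolve rec_add : rec.

Lemma rec_mul : rec2 muln.
Proof.
apply: (@Rec_ext _ _ (fun x => iteri x.2 (fun i r => r + x.1) 0)); last by rec.
by move=> [a b] /=; elim: b => [|b /= ->] /=; rewrite ?muln0 ?mulnS 1?addnC.
Qed.
#[local] Hint Resolve rec_mul : rec.

Lemma rec_exp : rec2 expn.
Proof.
apply: (@Rec_ext _ _ (fun x => iteri x.2 (fun i r => r * x.1) 1)); last by rec.
by move=> [a b] /=; elim: b => [|b /= ->] /=; rewrite ?expn0 ?expnSr.
Qed.
#[local] Hint Resolve rec_exp : rec.

Lemma rec_pred : rec1 predn.
Proof.
apply: (@Rec_ext _ _ (fun x => iteri x (fun i r => i) 0)); last by rec.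
by case.
Qed.
#[local] Hint Resolve rec_pred : rec.

Lemma rec_sub : rec2 subn.
Proof.
apply: (@Rec_ext _ _ (fun x => iteri x.2 (fun i r => r.-1) x.1)); last by rec.
by move=> [a b] /=; elim: b => [|b /= ->] /=; rewrite ?subn0 ?subnS.
Qed.
#[local] Hint Resolve rec_sub : rec.

Lemma rec_eq0 : rec1 (fun n => n == 0 : nat).
Proof. by apply: (@Rec_ext _ _ (fun x => 1 - x)); [case | rec]. Qed.

Lemma rec_leq : rec2 leq.
Proof.
apply: (@Rec_ext _ _ (fun x => (fun n => n == 0 : nat) (x.1 - x.2))) => //.
apply: (Rec_app1 rec_eq0); rec.
Qed.
#[local] Hint Resolve rec_leq : rec.

Lemma Rec_and X (ps : seq (X -> nat)) (a b : X -> bool) :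
  Rec ps a -> Rec ps b -> Rec ps (fun x => a x && b x).
Proof.
move=> Ha Hb; apply: (@Rec_ext _ _ (fun x => a x * b x)); last exact: Rec_app2 rec_mul Ha Hb.
by move=> x; rewrite mulnb.
Qed.

Lemma Rec_not X (ps : seq (X -> nat)) (a : X -> bool) :
  Rec ps a -> Rec ps (fun x => ~~ a x).
Proof.
move=> Ha; apply: (@Rec_ext _ _ (fun x => 1 - a x)); first by move=> x; case: (a x).
exact: Rec_app2 rec_sub (Rec_const _ _) Ha.
Qed.

Lemma Rec_if X (ps : seq (X -> nat)) (b : X -> bool) f g :
  Rec ps b -> Rec ps f -> Rec ps g -> Rec ps (fun x => if b x then f x else g x).
Proof.
move=> Hb Hf Hg.
apply: (@Rec_ext _ _ (fun x => b x * f x + (~~ b x) * g x)).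
  by move=> x; case: (b x); rewrite ?mul1n ?mul0n ?addn0.
by apply: (Rec_app2 rec_add); apply: (Rec_app2 rec_mul) => //; apply: Rec_not.
Qed.

Lemma iota0S n : iota 0 n.+1 = iota 0 n ++ [:: n].
Proof. by rewrite -[n.+1]addn1 iotaD. Qed.

Lemma Rec_count X (ps : seq (X -> nat)) N (P : nat -> X -> bool) : Rec ps N ->
  @Rec (nat * nat * X)
    [:: (fun y => y.1.1), (fun y => y.1.2) & [seq (fun y => p y.2) | p <- ps]]
    (fun y => P y.1.1 y.2) ->
  Rec ps (fun x => count (fun i => P i x) (iota 0 (N x))).
Proof.
move=> HN HP; apply: (@Rec_ext _ _ (fun x => iteri (N x) (fun i r => r + P i x) 0)).
  move=> x; elim: (N x) => // n IHn.
  by rewrite iteriS IHn iota0S count_cat /= addn0.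
apply: Rec_iteri => //; first exact: Rec_const.
by apply: (Rec_app2 rec_add) => //=; rec_proj.
Qed.

Lemma Rec_has X (ps : seq (X -> nat)) N (P : nat -> X -> bool) : Rec ps N ->
  @Rec (nat * nat * X)
    [:: (fun y => y.1.1), (fun y => y.1.2) & [seq (fun y => p y.2) | p <- ps]]
    (fun y => P y.1.1 y.2) ->
  Rec ps (fun x => has (fun i => P i x) (iota 0 (N x))).
Proof.
move=> HN HP; apply: (@Rec_ext _ _ (fun x => 0 < count (fun i => P i x) (iota 0 (N x)))).
  by move=> x; rewrite has_count.
apply: (Rec_app2 rec_leq); [exact: Rec_const | exact: Rec_count].
Qed.

Lemma Rec_all X (ps : seq (X -> nat)) N (P : nat -> X -> bool) : Rec ps N ->
  @Rec (nat * nat * X)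
    [:: (fun y => y.1.1), (fun y => y.1.2) & [seq (fun y => p y.2) | p <- ps]]
    (fun y => P y.1.1 y.2) ->
  Rec ps (fun x => all (fun i => P i x) (iota 0 (N x))).
Proof.
move=> HN HP.
apply: (@Rec_ext _ _ (fun x => ~~ has (fun i => ~~ P i x) (iota 0 (N x)))).
  by move=> x; rewrite -all_predC; congr nat_of_bool; apply: eq_all => i /=; rewrite negbK.
by apply: Rec_not; apply: Rec_has => //; apply: Rec_not.
Qed.

Lemma Rec_find X (ps : seq (X -> nat)) N (P : nat -> X -> bool) : Rec ps N ->
  @Rec (nat * nat * X)
    [:: (fun y => y.1.1), (fun y => y.1.2) & [seq (fun y => p y.2) | p <- ps]]
    (fun y => P y.1.1 y.2) ->
  Rec ps (fun x => find (fun i => P i x) (iota 0 (N x))).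
Proof.
(* The accumulator equals the counter [i] as long as nothing has been found, and stays at a smaller
   value afterwards. *)
move=> HN HP; apply: (@Rec_ext _ _ (fun x => iteri (N x)
    (fun i r => if r < i then r else if P i x then i else i.+1) 0)).
  move=> x; elim: (N x) => // n IHn.
  rewrite iteriS IHn iota0S find_cat has_find size_iota /=.
  by case: ifP => // _; case: (P n x); rewrite ?addn0 ?addn1.
apply: Rec_iteri => //; first exact: Rec_const.
apply: Rec_if; first by apply: (Rec_app2 rec_leq); rec.
  by rec.
by apply: Rec_if => //; rec.
Qed.

Ltac rec_struct ::= match goal with
  | |- Rec _ (fun x => nat_of_bool (andb (@?a x) (@?b x))) => apply: (@Rec_and _ _ a b)
  | |- Rec _ (fun x => nat_of_bool (negb (@?a x))) => apply: (@Rec_not _ _ a)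
  | |- Rec _ (fun x => nat_of_bool (has _ (iota 0 _))) => apply: Rec_has
  | |- Rec _ (fun x => nat_of_bool (all _ (iota 0 _))) => apply: Rec_all
  | |- Rec _ (fun x => count _ (iota 0 _)) => apply: Rec_count
  | |- Rec _ (fun x => find _ (iota 0 _)) => apply: Rec_find
  end.
Ltac rec_cond ::= apply: Rec_if.

Lemma rec_eq : rec2 (fun a b => a == b).
Proof.
apply: (@Rec_ext _ _ (fun x => (x.1 <= x.2) && (x.2 <= x.1))); last by rec.
by move=> [a b]; rewrite -eqn_leq.
Qed.
#[local] Hint Resolve rec_eq : rec.

Lemma count_lt_iota q n : q <= n -> count (fun i => i < q) (iota 0 n) = q.
Proof.
elim: n q => [|n IHn] q leqn; first by case: q leqn.
rewrite iota0S count_cat /= addn0; case: (ltnP n q) => [ltnq|]; last first.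
  by move=> ?; rewrite IHn // addn0.
have -> : q = n.+1 by lia.
rewrite (@eq_in_count _ _ predT) ?count_predT ?size_iota ?addn1 // => i.
by rewrite mem_iota /=; lia.
Qed.

Lemma rec_div : rec2 divn.
Proof.
(* The quotient counts the positive multiples of the divisor up to the dividend; the guard
   reproduces [n %/ 0 = 0]. *)
apply: (@Rec_ext _ _ (fun x => count (fun i => (0 < x.2) && (i.+1 * x.2 <= x.1))
                                     (iota 0 x.1))); last by rec.
move=> [a [|b]] /=; first by rewrite divn0 (@eq_count _ _ pred0) ?count_pred0.
rewrite (@eq_count _ _ (fun i => i < a %/ b.+1)) ?count_lt_iota ?leq_div // => i.
by rewrite -leq_divRL.
Qed.
#[local] Hint Resolve rec_div : rec.

Lemma rec_mod : rec2 modn.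
Proof.
apply: (@Rec_ext _ _ (fun x => x.1 - x.1 %/ x.2 * x.2)); last by rec.
by move=> [a b] /=; rewrite {1}(divn_eq a b) addKn.
Qed.
#[local] Hint Resolve rec_mod : rec.

Lemma rec_odd : rec1 (fun n => odd n).
Proof.
by apply: (@Rec_ext _ _ (fun x => x %% 2)); [move=> x; rewrite modn2 | rec].
Qed.
#[local] Hint Resolve rec_odd : rec.

(** * A universal stack machine *)

(* An injective, not surjective, pairing; [p1 0 = p2 0 = 0], so [0] doubles as the empty
   list and as the empty stack. *)
Definition pr a b := (a + b) * (a + b) + a.
Definition sqrtn z := find (fun s => z < s.+1 * s.+1) (iota 0 z.+1).
Definition p1 z := z - sqrtn z * sqrtn z.
Definition p2 z := sqrtn z - p1 z.

Lemma find_iota_spec (P : pred nat) n k : k < n -> P k ->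
  [/\ find P (iota 0 n) <= k, P (find P (iota 0 n))
    & forall i, i < find P (iota 0 n) -> ~~ P i].
Proof.
move=> ltkn Pk.
have hP : has P (iota 0 n) by apply/hasP; exists k; rewrite ?mem_iota.
have ltf : find P (iota 0 n) < n by rewrite -[X in _ < X](size_iota 0 n) -has_find.
have nf i : i < find P (iota 0 n) -> ~~ P i.
  move=> lti; have := before_find 0 lti; rewrite nth_iota; last exact: ltn_trans ltf.
  by rewrite add0n => ->.
split=> //; last by have := nth_find 0 hP; rewrite nth_iota.
by case: leqP => // /nf; rewrite Pk.
Qed.

Lemma find_iota (P : pred nat) n k :
  k < n -> P k -> (forall i, i < k -> ~~ P i) -> find P (iota 0 n) = k.
Proof.
move=> ltkn Pk nP; have [lef Pf _] := find_iota_spec ltkn Pk.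
by apply/eqP; rewrite eqn_leq lef leqNgt; apply/negP => /nP; rewrite Pf.
Qed.

Lemma sqrtn_pr a b : sqrtn (pr a b) = a + b.
Proof. by apply: find_iota; rewrite /pr; [nia | nia | move=> i lti; rewrite -leqNgt; nia]. Qed.

Lemma p1_pr a b : p1 (pr a b) = a.
Proof. by rewrite /p1 sqrtn_pr /pr addKn. Qed.

Lemma p2_pr a b : p2 (pr a b) = b.
Proof. by rewrite /p2 p1_pr sqrtn_pr addKn. Qed.

Lemma rec_pr : rec2 pr. Proof. rewrite /pr; rec. Qed.
#[local] Hint Resolve rec_pr : rec.
Lemma rec_sqrtn : rec1 sqrtn. Proof. rewrite /sqrtn; rec. Qed.
#[local] Hint Resolve rec_sqrtn : rec.
Lemma rec_p1 : rec1 p1. Proof. rewrite /p1; rec. Qed.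
#[local] Hint Resolve rec_p1 : rec.
Lemma rec_p2 : rec1 p2. Proof. rewrite /p2; rec. Qed.
#[local] Hint Resolve rec_p2 : rec.

Definition lcons h t := (pr h t).+1.
Definition hd v := p1 v.-1.
Definition tl v := p2 v.-1.
Definition encl := foldr lcons 0.
Arguments encl : simpl never.

Lemma lcons_encl x s : lcons x (encl s) = encl (x :: s).
Proof. by []. Qed.

Lemma hd_encl s : hd (encl s) = head 0 s.
Proof. by case: s => // x s; rewrite -lcons_encl /hd /= p1_pr. Qed.
Lemma tl_encl s : tl (encl s) = encl (behead s).
Proof. by case: s => // x s; rewrite -lcons_encl /tl /= p2_pr. Qed.

Lemma rec_lcons : rec2 lcons. Proof. rewrite /lcons; rec. Qed.
Lemma rec_hd : rec1 hd. Proof. rewrite /hd; rec. Qed.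
Lemma rec_tl : rec1 tl. Proof. rewrite /tl; rec. Qed.
#[local] Hint Resolve rec_lcons rec_hd rec_tl : rec.

(** * Program codes and the transition function *)

Definition node tag a b := pr tag (pr a b).
Definition arg1 n := p1 (p2 n).
Definition arg2 n := p2 (p2 n).

Lemma tag_node t a b : p1 (node t a b) = t. Proof. exact: p1_pr. Qed.
Lemma arg1_node t a b : arg1 (node t a b) = a.
Proof. by rewrite /arg1 p2_pr p1_pr. Qed.
Lemma arg2_node t a b : arg2 (node t a b) = b.
Proof. by rewrite /arg2 p2_pr p2_pr. Qed.

Lemma rec_node : rec3 node. Proof. rewrite /node; rec. Qed.
Lemma rec_arg1 : rec1 arg1. Proof. rewrite /arg1; rec. Qed.
Lemma rec_arg2 : rec1 arg2. Proof. rewrite /arg2; rec. Qed.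
#[local] Hint Resolve rec_node rec_arg1 rec_arg2 : rec.

(** Tag 6 makes argument lists into programs; they end in the code of [CZero], whose value 0 also
    codes the empty list. *)
Fixpoint enc (c : code) : nat :=
  match c with
  | CZero => node 0 0 0
  | CSucc => node 1 0 0
  | CProj i => node 2 i 0
  | CComp f gs => node 3 (enc f) (foldr (fun g r => node 6 (enc g) r) (node 0 0 0) gs)
  | CPrec f g => node 4 (enc f) (enc g)
  | CMu f => node 5 (enc f) 0
  end.
Definition encs := foldr (fun g r => node 6 (enc g) r) (node 0 0 0).

(* [evst c v K] evaluates the program [c] on the list [v] with continuation stack [K];
   [rtst v K] returns [v] to [K]. *)
Definition evst c v K := node c.+1 v K.
Definition rtst v K := node 0 v K.

Definition ev_step c v K :=
  let a := arg1 c in let b := arg2 c in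
  if p1 c == 0 then rtst 0 K
  else if p1 c == 1 then rtst (hd v).+1 K
  else if p1 c == 2 then
    if a == 0 then rtst (hd v) K else evst (node 2 a.-1 b) (tl v) K
  else if p1 c == 3 then evst b v (node 3 a K)
  else if p1 c == 4 then
    if hd v == 0 then evst a (tl v) K
    else evst c (lcons (hd v).-1 (tl v)) (node 4 b (pr (lcons (hd v).-1 (tl v)) K))
  else if p1 c == 5 then evst a (lcons 0 v) (node 5 a (pr (lcons 0 v) K))
  else evst a v (node 1 b (pr v K)).

(** Continuation frames: 0 halts, 1 holds the remaining arguments, 2 a value awaiting the rest of
    its list, 3 the outer function of a composition, 4 the step of a primitive recursion, 5 a search
    under way. *)
Definition rt_step v K :=
  let a := arg1 K in let b := arg2 K in let l := p1 b in let K' := p2 b in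
  if p1 K == 0 then rtst v K
  else if p1 K == 1 then evst a l (node 2 v K')
  else if p1 K == 2 then rtst (lcons a v) b
  else if p1 K == 3 then evst a v b
  else if p1 K == 4 then evst a (lcons (hd l) (lcons v (tl l))) K'
  else if v == 0 then rtst (hd l) K'
  else evst a (lcons (hd l).+1 (tl l)) (node 5 a (pr (lcons (hd l).+1 (tl l)) K')).

Definition step s :=
  if p1 s == 0 then rt_step (arg1 s) (arg2 s)
  else ev_step (p1 s).-1 (arg1 s) (arg2 s).

Lemma step_evst c v K : step (evst c v K) = ev_step c v K.
Proof. by rewrite /step tag_node arg1_node arg2_node. Qed.
Lemma step_rtst v K : step (rtst v K) = rt_step v K.
Proof. by rewrite /step tag_node arg1_node arg2_node. Qed.

Lemma rec_evst : rec3 evst. Proof. rewrite /evst; rec. Qed.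
Lemma rec_rtst : rec2 rtst. Proof. rewrite /rtst; rec. Qed.
#[local] Hint Resolve rec_evst rec_rtst : rec.
Lemma rec_ev_step : rec3 ev_step. Proof. rewrite /ev_step; rec. Qed.
Lemma rec_rt_step : rec2 rt_step. Proof. rewrite /rt_step; rec. Qed.
#[local] Hint Resolve rec_ev_step rec_rt_step : rec.
Lemma rec_step : rec1 step. Proof. rewrite /step; rec. Qed.
#[local] Hint Resolve rec_step : rec.

(** * Correctness of the machine *)

Definition reach s s' := exists n, iter n step s = s'.
Lemma reach_trans s2 s1 s3 : reach s1 s2 -> reach s2 s3 -> reach s1 s3.
Proof. by move=> [n <-] [m <-]; exists (m + n); rewrite iterD. Qed.
Lemma reach_step s1 s2 : reach (step s1) s2 -> reach s1 s2.
Proof. by move=> [n <-]; exists n.+1; rewrite iterSr. Qed.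
Lemma reach_refl s : reach s s. Proof. by exists 0. Qed.

Ltac mstep := apply: reach_step; rewrite ?step_evst ?step_rtst /ev_step /rt_step
  !tag_node ?arg1_node ?arg2_node ?p1_pr ?p2_pr ?hd_encl ?tl_encl /= ?lcons_encl.

Lemma reach_proj i xs K : reach (evst (node 2 i 0) (encl xs) K) (rtst (nth 0 xs i) K).
Proof.
elim: i xs => [|i IHi] xs; mstep; first by rewrite nth0; apply: reach_refl.
by have := IHi (behead xs); rewrite nth_behead.
Qed.

Fixpoint reach_eval c xs y (H : eval c xs y) {struct H} : forall K,
    reach (evst (enc c) (encl xs) K) (rtst y K)
with reach_evals gs xs ys (H : evals gs xs ys) {struct H} : forall K,
    reach (evst (encs gs) (encl xs) K) (rtst (encl ys) K).
Proof.
- case: H => {c xs y} /=.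
  + by move=> xs K; mstep; apply: reach_refl.
  + by move=> xs K; mstep; apply: reach_refl.
  + by move=> i xs K; apply: reach_proj.
  + move=> f gs xs ys y Hgs Hf K; mstep.
    apply: reach_trans (reach_evals _ _ _ Hgs _) _; mstep.
    exact: (reach_eval _ _ _ Hf).
  + by move=> f g xs y Hf K; mstep; exact: (reach_eval _ _ _ Hf).
  + move=> f g n xs r y Hn Hg K; mstep.
    apply: reach_trans (reach_eval _ _ _ Hn _) _; mstep.
    exact: (reach_eval _ _ _ Hg).
  + move=> f xs n Hn Hm K; mstep.
    (* The machine tries the candidates in turn; the values below [n] are nonzero, so the frame
       advances to [n]. *)
    have G m : m <= n -> reach (evst (enc f) (encl (0 :: xs)) (node 5 (enc f) (pr (encl (0 :: xs)) K)))
        (evst (enc f) (encl (m :: xs)) (node 5 (enc f) (pr (encl (m :: xs)) K))).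
      elim: m => [|m IHm] ltmn; first exact: reach_refl.
      apply: reach_trans (IHm (ltnW ltmn)) _.
      case: (Hm m ltmn) => k Hk.
      apply: reach_trans (reach_eval _ _ _ Hk _) _; mstep.
      exact: reach_refl.
    apply: reach_trans (G n (leqnn n)) _.
    apply: reach_trans (reach_eval _ _ _ Hn _) _; mstep.
    exact: reach_refl.
- case: H => {gs xs ys} /=.
  + by move=> xs K; mstep; apply: reach_refl.
  + move=> g gs xs y ys Hg Hgs K; mstep.
    apply: reach_trans (reach_eval _ _ _ Hg _) _; mstep.
    apply: reach_trans (reach_evals _ _ _ Hgs _) _; mstep.
    exact: reach_refl.
Qed.

Definition outputs1 e x a b c t := iter t step (evst e (encl [:: x; a; b; c]) 0) == rtst 1 0.
Definition accepts e x a b t := has (fun c => outputs1 e x a b c t) (iota 0 t).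

Lemma rec_accepts : rec5 accepts.
Proof.
apply: (@Rec_ext _ _ (fun q => has (fun c => iteri q.2 (fun _ s => step s)
  (evst q.1.1.1.1 (lcons q.1.1.1.2 (lcons q.1.1.2 (lcons q.1.2 (lcons c 0)))) 0) == rtst 1 0)
   (iota 0 q.2))); last by rec.
by move=> [[[[e x] a] b] t]; congr nat_of_bool; apply: eq_has.
Qed.
#[local] Hint Resolve rec_accepts : rec.

Lemma iter_rtst0 n v : iter n step (rtst v 0) = rtst v 0.
Proof. by elim: n => //= n ->; rewrite step_rtst. Qed.

(** Halted states are fixed, so an accepting run stays accepting as [t] grows. Conversely, running
    past both halting times leads to one state, so an accepted [c] does satisfy [R]. *)
Lemma universal R : recursive_rel4 R -> exists e, forall x a b,
  (forall c, R x a b c -> exists t0, forall t, t0 <= t -> accepts e x a b t) /\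
  (forall t, accepts e x a b t -> exists c, R x a b c).
Proof.
move=> [e0 He]; exists (enc e0) => x a b; split.
  move=> c Rc; have := He x a b c; rewrite Rc => /reach_eval /(_ 0) [n Hn].
  exists (maxn c.+1 n) => t; rewrite geq_max => /andP [ltct lent].
  apply/hasP; exists c; rewrite ?mem_iota //= /outputs1 -(subnK lent) iterD Hn.
  by rewrite iter_rtst0.
move=> t /hasP [c _ /eqP H1]; exists c.
have /reach_eval /(_ 0) [n Hn] := He x a b c.
have : rtst 1 0 = rtst (R x a b c) 0.
  rewrite -(iter_rtst0 n 1) -H1 -(iter_rtst0 t) -Hn /=.
  by rewrite -!iterD addnC.
by move/(congr1 arg1); rewrite !arg1_node; case: (R x a b c).
Qed.

(** * The colouring *)

Definition dig j n := (n %/ 3 ^ j) %% 3.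
Definition hi j n := n %/ 3 ^ j.+1 * 3 ^ j.+1.
(** The 3-adic valuation and the position of the leading digit, for positive [n]; searching below
    [n] is enough because [n < 3 ^ n]. *)
Definition val3 n := find (fun j => 0 < n %% 3 ^ j.+1) (iota 0 n).
Definition log3 n := find (fun j => n < 3 ^ j.+1) (iota 0 n).

Lemma rec_dig : rec2 dig. Proof. rewrite /dig; rec. Qed.
Lemma rec_hi : rec2 hi. Proof. rewrite /hi; rec. Qed.
Lemma rec_val3 : rec1 val3. Proof. rewrite /val3; rec. Qed.
Lemma rec_log3 : rec1 log3. Proof. rewrite /log3; rec. Qed.
#[local] Hint Resolve rec_dig rec_hi rec_val3 rec_log3 : rec.

(** * Guesses of the requirements, and the bits [chi] *)

Definition lnth k p := hd (iteri k (fun _ => tl) p).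
Definition elt k p := p1 (lnth k p).
Definition wit k p := p2 (lnth k p).

Lemma lnth_encl k s : lnth k (encl s) = nth 0 s k.
Proof.
rewrite /lnth; have -> : iteri k (fun=> tl) (encl s) = encl (drop k s).
  elim: k => [|k IHk]; first by rewrite drop0.
  by rewrite iteriS IHk tl_encl -drop1 drop_drop.
by rewrite hd_encl -nth0 nth_drop addn0.
Qed.

Lemma rec_lnth : rec2 lnth. Proof. rewrite /lnth; rec. Qed.
#[local] Hint Resolve rec_lnth : rec.
Lemma rec_elt : rec2 elt. Proof. rewrite /elt; rec. Qed.
Lemma rec_wit : rec2 wit. Proof. rewrite /wit; rec. Qed.
#[local] Hint Resolve rec_elt rec_wit : rec.

(* [p] codes a list of pairs of an element and a witness for the outermost quantifier of
   the [e]-th Sigma^0_3 definition; [b] bounds the universal quantifier and [t] the search. *)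
Definition plausible e p b t := all (fun k =>
  (0 < elt k p) && (log3 (elt k p) < log3 (elt k.+1 p)) &&
  all (fun i => accepts e (elt k p) (wit k p) i t) (iota 0 b)) (iota 0 (2 ^ e)).
Definition guess e u := find (fun p => plausible e p (val3 u) u) (iota 0 u).
(** A failing [find] returns the length of its range: [slot e j u = 2 ^ e] means that requirement
    [e] proposes nothing with leading position [j], and [claimant j u = u] that no requirement below
    [u] does. Otherwise the least index wins. *)
Definition slot e j u := find (fun k => log3 (elt k (guess e u)) == j) (iota 0 (2 ^ e)).
Definition claimant j u := find (fun e => slot e j u < 2 ^ e) (iota 0 u).
Definition target j u := elt (slot (claimant j u) j u) (guess (claimant j u) u).

Lemma rec_plausible : rec4 plausible. Proof. rewrite /plausible; rec. Qed.
#[local] Hint Resolve rec_plausible : rec.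
Lemma rec_guess : rec2 guess. Proof. rewrite /guess; rec. Qed.
#[local] Hint Resolve rec_guess : rec.
Lemma rec_slot : rec3 slot. Proof. rewrite /slot; rec. Qed.
#[local] Hint Resolve rec_slot : rec.
Lemma rec_claimant : rec2 claimant. Proof. rewrite /claimant; rec. Qed.
#[local] Hint Resolve rec_claimant : rec.
Lemma rec_target : rec2 target. Proof. rewrite /target; rec. Qed.
#[local] Hint Resolve rec_target : rec.

(** For the target [x], the bit negates the parity of the terms of the lower digits, so that all
    digits of [x] in [x + u] contribute an odd total; [hi i x + u] is [hi i (x + u)] for divisible
    enough [u]. Calls go to [i < j], hence the fuel. *)
Fixpoint chi_fuel n j u : bool :=
  if n is m.+1 then
    (claimant j u < u) && ~~ odd (count (fun i =>
      (0 < dig i (target j u)) && chi_fuel m i (hi i (target j u) + u)) (iota 0 j))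
  else false.
Definition chi j u := chi_fuel j.+1 j u.

Lemma chi_fuel_enough n j u : j < n -> chi_fuel n j u = chi j u.
Proof.
rewrite /chi; elim/ltn_ind: j n u => j IHj [//|n] u ltjn /=.
congr (_ && ~~ odd _); apply: eq_in_count => i; rewrite mem_iota add0n => /= ltij.
by rewrite !IHj //; lia.
Qed.

Lemma chiE j u : chi j u = (claimant j u < u) && ~~ odd (count (fun i =>
  (0 < dig i (target j u)) && chi i (hi i (target j u) + u)) (iota 0 j)).
Proof.
rewrite {1}/chi /=; congr (_ && ~~ odd _); apply: eq_in_count => i.
by rewrite mem_iota add0n => /= ltij; rewrite chi_fuel_enough.
Qed.

(* [T] stores [chi i v] as bit [i * N + v]: the recursive calls of [chi] change its second
   argument, so course-of-values recursion needs a table over all [v < N]. *)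
Definition chi_row N k T :=
  (claimant (k %/ N) (k %% N) < k %% N) && ~~ odd (count (fun i =>
    (0 < dig i (target (k %/ N) (k %% N))) &&
    odd (T %/ 2 ^ (i * N + (hi i (target (k %/ N) (k %% N)) + k %% N))))
  (iota 0 (k %/ N))).
Definition chi_tab N k := iteri k (fun k r => r + chi_row N k r * 2 ^ k) 0.

(** * Correctness of the table for [chi] *)

Lemma chi_tab_lt N k : chi_tab N k < 2 ^ k.
Proof.
by elim: k => // k; rewrite /chi_tab iteriS expnS => lt; case: chi_row; lia.
Qed.

Lemma chi_tab_bit N k i : i < k ->
  odd (chi_tab N k %/ 2 ^ i) = chi_row N i (chi_tab N i).
Proof.
elim: k => // k IHk; rewrite ltnS leq_eqVlt => /predU1P [->|ltik].
  rewrite {1}/chi_tab iteriS -/(chi_tab N k) addnC divnMDl ?expn_gt0 //.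
  by rewrite divn_small ?chi_tab_lt // addn0; case: chi_row.
rewrite -IHk // {1}/chi_tab iteriS -/(chi_tab N k) -(subnK (ltnW ltik)).
rewrite addnC expnD mulnA divnMDl ?expn_gt0 // oddD oddM oddX.
by rewrite subn_eq0 leqNgt ltik andbF subnK // ltnW.
Qed.

(** Keeps the recursive calls of [chi] inside the table: the bound [v + 3 ^ j.+1 <= N] passes from
    [(j, v)] to [(i, hi i x + v)]. *)
Lemma hi_add_leq i x j : x < 3 ^ j.+1 -> i < j -> hi i x + 3 ^ i.+1 <= 3 ^ j.+1.
Proof.
move=> ltx ltij; rewrite /hi; have -> : j.+1 = (j - i) + i.+1 by lia.
rewrite expnD -mulSnr leq_mul2r; apply/orP; right.
rewrite ltn_divLR ?expn_gt0 // -expnD.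
by have <- : j.+1 = (j - i) + i.+1 by lia.
Qed.

Lemma lt_exp3 n : n < 3 ^ n. Proof. exact: ltn_expl. Qed.

Lemma log3_spec x : 0 < x -> 3 ^ log3 x <= x < 3 ^ (log3 x).+1.
Proof.
move=> x0; have [||_ lt nlt] := @find_iota_spec (fun j => x < 3 ^ j.+1) x x.-1.
- by lia.
- by rewrite prednK // lt_exp3.
rewrite -/(log3 x) in lt nlt; rewrite lt andbT.
by case: (log3 x) nlt => // t /(_ t (leqnn _)); rewrite -leqNgt.
Qed.

Lemma lt_exp_log3 x : x < 3 ^ (log3 x).+1.
Proof. by case: (posnP x) => [->|/log3_spec/andP[]//]; rewrite expn_gt0. Qed.

Lemma log3_slot e j u : slot e j u < 2 ^ e -> log3 (elt (slot e j u) (guess e u)) = j.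
Proof.
move=> lt; have h : has (fun k => log3 (elt k (guess e u)) == j) (iota 0 (2 ^ e)).
  by rewrite has_find size_iota.
by have /eqP := nth_find 0 h; rewrite nth_iota // add0n.
Qed.

Lemma log3_target j u : claimant j u < u -> log3 (target j u) = j.
Proof.
move=> lt; apply: log3_slot.
have h : has (fun e => slot e j u < 2 ^ e) (iota 0 u) by rewrite has_find size_iota.
by have := nth_find 0 h; rewrite nth_iota // add0n.
Qed.

Lemma chi_tabE N j v : v + 3 ^ j.+1 <= N ->
  chi_row N (j * N + v) (chi_tab N (j * N + v)) = chi j v.
Proof.
elim/ltn_ind: j v => j IHj v leN.
have e3 : 0 < 3 ^ j.+1 by rewrite expn_gt0.
have ltv : v < N by lia.
rewrite chiE /chi_row divnMDl ?(divn_small ltv) ?addn0 ?modnMDl ?(modn_small ltv); last by lia.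
case: (ltnP (claimant j v) v) => //= /log3_target tj.
congr (~~ odd _); apply: eq_in_count => i; rewrite mem_iota add0n => /= ltij.
congr (_ && _).
have := lt_exp_log3 (target j v); rewrite tj => /hi_add_leq /(_ ltij) leh.
have e3i : 0 < 3 ^ i.+1 by rewrite expn_gt0.
rewrite chi_tab_bit ?IHj //; first by lia.
(* Cells of row [i] precede those of row [j], so the bit needed is already written. *)
have : i.+1 * N <= j * N by rewrite leq_mul2r ltij orbT.
by rewrite mulSn; lia.
Qed.

Lemma rec_chi_row : rec3 chi_row. Proof. rewrite /chi_row; rec. Qed.
#[local] Hint Resolve rec_chi_row : rec.
Lemma rec_chi_tab : rec2 chi_tab. Proof. rewrite /chi_tab; rec. Qed.
#[local] Hint Resolve rec_chi_tab : rec.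
Lemma rec_chi : rec2 chi.
Proof.
apply: (@Rec_ext _ _ (fun x =>
  chi_row (x.2 + 3 ^ x.1.+1) (x.1 * (x.2 + 3 ^ x.1.+1) + x.2)
    (chi_tab (x.2 + 3 ^ x.1.+1) (x.1 * (x.2 + 3 ^ x.1.+1) + x.2)))); last by rec.
by move=> [j u] /=; rewrite chi_tabE.
Qed.
#[local] Hint Resolve rec_chi : rec.

Definition parity n := odd (count (fun j => (0 < dig j n) && chi j (hi j n)) (iota 0 n)).

Definition colouring n : colour3 := (dig (val3 n) n == 1, parity n, false).

Lemma colouring_recursive : recursive_coloring colouring.
Proof.
have : rec1 (fun n => 4 * (dig (val3 n) n == 1) + 2 * parity n + false).
  by rewrite /parity; rec.
by [].
Qed.

(** * Diagonalization *)

Lemma dig_small j n : n < 3 ^ j -> dig j n = 0.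
Proof. by move=> lt; rewrite /dig divn_small. Qed.

Lemma count_dig_widen n m (P : nat -> bool) : n <= m ->
  count (fun j => (0 < dig j n) && P j) (iota 0 m) =
  count (fun j => (0 < dig j n) && P j) (iota 0 n).
Proof.
move=> /subnKC <-; rewrite iotaD count_cat [X in _ + X](_ : _ = 0) ?addn0 //.
apply/eqP; rewrite -leqn0 leqNgt -has_count; apply/hasPn => j.
rewrite mem_iota add0n => /andP [lenj _]; rewrite dig_small //.
by apply: leq_ltn_trans lenj (lt_exp3 j).
Qed.

Lemma dig_log3_gt0 x : 0 < x -> 0 < dig (log3 x) x.
Proof.
move=> /log3_spec /andP [le lt]; rewrite /dig modn_small ?divn_gt0 ?expn_gt0 //.
by rewrite ltn_divLR ?expn_gt0 // -expnS.
Qed.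

Lemma dig_low x u k i : 3 ^ k %| u -> i < k -> dig i (x + u) = dig i x.
Proof.
move=> /dvdnP [q ->] lti; rewrite /dig.
have -> : k = (k - i.+1) + 1 + i by lia.
by rewrite !expnD !mulnA addnC divnMDl ?expn_gt0 // expn1 modnMDl.
Qed.

Lemma dig_low0 u k i : 3 ^ k %| u -> i < k -> dig i u = 0.
Proof.
by move=> dvdu lti; rewrite -[u]add0n (dig_low 0 dvdu) // /dig div0n.
Qed.

Lemma hi_low x u k i : 3 ^ k %| u -> i < k -> hi i (x + u) = hi i x + u.
Proof.
move=> /dvdnP [q ->] lti; rewrite /hi.
have -> : k = (k - i.+1) + i.+1 by lia.
by rewrite expnD mulnA addnC divnMDl ?expn_gt0 // mulnDl addnC.
Qed.

Lemma div_high x u k i : x < 3 ^ k -> 3 ^ k %| u -> k <= i ->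
  (x + u) %/ 3 ^ i = u %/ 3 ^ i.
Proof.
move=> ltx /dvdnP [q ->] lei; have -> : i = k + (i - k) by lia.
rewrite expnD !divnMA addnC divnMDl ?expn_gt0 // mulnK ?expn_gt0 //.
by rewrite (divn_small ltx) addn0.
Qed.

(** Split the digits of [x + u] at [j = log3 x]. Up to [j] they are those of [x], with an odd total
    by the choice of [chi j u]; above [j] they are those of [u], with the same terms. The digits of
    [u] up to [j] vanish. *)
Lemma parity_target x u : 0 < x -> 0 < u -> 3 ^ (log3 x).+1 %| u ->
  claimant (log3 x) u < u -> target (log3 x) u = x -> parity (x + u) = ~~ parity u.
Proof.
move=> x0 u0 dvdu cl tgt; have ltx := lt_exp_log3 x.
pose j := log3 x; rewrite -/j in dvdu cl tgt ltx.
have ltju : j.+1 < x + u.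
  apply: leq_trans (lt_exp3 j.+1) _; apply: leq_trans (dvdn_leq u0 dvdu) _.
  exact: leq_addl.
rewrite /parity -(count_dig_widen _ (leq_addl x u)).
have -> : iota 0 (x + u) = iota 0 j ++ j :: iota j.+1 (x + u - j.+1).
  by rewrite -{1}(subnKC (ltnW ltju)) iotaD iota0S -catA.
rewrite !count_cat /=.
rewrite (dig_low _ dvdu) // (hi_low _ dvdu) // (dig_low0 dvdu) //=.
have -> : hi j x = 0 by rewrite /hi divn_small.
rewrite add0n dig_log3_gt0 // [X in _ = ~~ odd (X + _)](_ : _ = 0); last first.
  apply/eqP; rewrite -leqn0 leqNgt -has_count; apply/hasPn => i.
  rewrite mem_iota add0n => /= ltij; rewrite (dig_low0 dvdu) //.
  exact: leqW.
rewrite chiE cl tgt.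
set c1 := count _ (iota 0 j); set c2 := count _ (iota 0 j).
have -> : c1 = c2.
  apply: eq_in_count => i; rewrite mem_iota add0n => /= ltij.
  by rewrite (dig_low _ dvdu) ?(hi_low _ dvdu) // leqW.
set d1 := count _ (iota j.+1 _); set d2 := count _ (iota j.+1 _).
have -> : d1 = d2.
  apply: eq_in_count => i; rewrite mem_iota => /andP [ltji _].
  by rewrite /dig /hi !(div_high ltx dvdu) // leqW.
by rewrite /= !oddD; case: (odd c2); case: (odd d2).
Qed.

(** * Valuations and lowest digits *)

Lemma val3_uniq a n : 3 ^ a %| n -> ~~ (3 ^ a.+1 %| n) -> val3 n = a.
Proof.
move=> dvd ndvd; have n0 : 0 < n by rewrite lt0n; apply: contraNneq ndvd => ->.
apply: find_iota.
- by apply: leq_trans (lt_exp3 a) _; apply: dvdn_leq.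
- by rewrite lt0n.
- move=> i lti; rewrite -eqn0Ngt; apply: dvdn_trans dvd.
  exact: dvdn_exp2l.
Qed.

Lemma val3_ge a n : 0 < n -> 3 ^ a %| n -> a <= val3 n.
Proof.
move=> n0 dvd; rewrite leqNgt; apply/negP => lt.
have [||_ P _] := @find_iota_spec (fun j => 0 < n %% 3 ^ j.+1) n n.-1.
- by lia.
- by rewrite prednK // modn_small ?lt_exp3.
move: P; rewrite -/(val3 n) lt0n => /negP; apply.
by apply: dvdn_trans dvd; apply: dvdn_exp2l.
Qed.

Lemma val3_spec n : 0 < n -> 3 ^ val3 n %| n /\ ~~ (3 ^ (val3 n).+1 %| n).
Proof.
move=> n0; have [||_ P nP] := @find_iota_spec (fun j => 0 < n %% 3 ^ j.+1) n n.-1.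
- by lia.
- by rewrite prednK // modn_small ?lt_exp3.
rewrite -/(val3 n) in P nP; split; last by rewrite /dvdn -lt0n.
case: (val3 n) nP => [|l] nP; first by rewrite dvd1n.
by have := nP l (leqnn _); rewrite -eqn0Ngt.
Qed.

(** Equal first bits force equal lowest digits; doubling swaps 1 and 2 modulo 3, so the sum keeps
    the valuation and changes the bit. *)
Lemma same_valuation M y z : 3 ^ M %| y -> 3 ^ M %| z ->
  ~~ (3 ^ M.+1 %| y) -> ~~ (3 ^ M.+1 %| z) ->
  (dig (val3 y) y == 1) = (dig (val3 z) z == 1) ->
  (dig (val3 y) y == 1) = (dig (val3 (y + z)) (y + z) == 1) -> False.
Proof.
move=> dy dz ny nz; rewrite (val3_uniq dy ny) (val3_uniq dz nz).
case/dvdnP: dy ny => a ->; case/dvdnP: dz nz => b ->.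
have e3 : 0 < 3 ^ M by rewrite expn_gt0.
rewrite expnS !dvdn_pmul2r // -mulnDl => nb na eab.
have nab : ~~ (3 %| a + b).
  move: na nb eab; rewrite /dig !mulnK // /dvdn -modnDm.
  have := ltn_pmod a (isT : 0 < 3); have := ltn_pmod b (isT : 0 < 3).
  by case: (a %% 3) => [|[|[|]]] //; case: (b %% 3) => [|[|[|]]].
have -> : val3 ((a + b) * 3 ^ M) = M.
  by apply: val3_uniq; [exact: dvdn_mull | rewrite expnS dvdn_pmul2r].
move: na nb eab; rewrite /dig !mulnK // /dvdn -[(a + b) %% 3]modnDm.
have := ltn_pmod a (isT : 0 < 3); have := ltn_pmod b (isT : 0 < 3).
by case: (a %% 3) => [|[|[|]]] //; case: (b %% 3) => [|[|[|]]].
Qed.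

(** * Refuting a monochromatic set *)

Section Diagonal.
Variables (A : nat -> Prop) (col : colour3).
Hypothesis infA : infinite_set A.
Hypothesis monoA : forall n, FSle 3 A n -> colouring n = col.

Lemma mono1 x : A x -> colouring x = col.
Proof.
move=> Ax; apply: monoA; exists [:: x]; split=> //; last by rewrite /= addn0.
by move=> t; rewrite inE => /eqP ->.
Qed.

Lemma mono2 x y : A x -> A y -> x < y -> colouring (x + y) = col.
Proof.
move=> Ax Ay lt; apply: monoA; exists [:: x; y]; split=> //.
- by rewrite /= inE andbT neq_ltn lt.
- by move=> t; rewrite !inE => /orP [] /eqP ->.
- by rewrite /= addn0.
Qed.

Lemma mono3 x y z : A x -> A y -> A z -> x < y -> y < z ->
  colouring (x + (y + z)) = col.
Proof.
move=> Ax Ay Az ltxy ltyz; apply: monoA; exists [:: x; y; z]; split=> //.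
- by rewrite /= !inE andbT negb_or !neq_ltn ltxy ltyz (ltn_trans ltxy).
- by move=> t; rewrite !inE => /or3P [] /eqP ->.
- by rewrite /= addn0.
Qed.

(** Among late members, all divisible by [3 ^ M], at most one is not divisible by [3 ^ M.+1], by
    [same_valuation]; the new threshold lies just past it. *)
Lemma eventually_dvd M : exists N, forall y, A y -> N <= y -> 3 ^ M %| y.
Proof.
elim: M => [|M [N HN]]; first by exists 0 => y _ _; rewrite dvd1n.
case: (classic (exists y, [/\ A y, N <= y & ~~ (3 ^ M.+1 %| y)])); last first.
  move=> none; exists N => y Ay leN; apply: contraT => nd.
  by case: none; exists y.
move=> [y [Ay leN nd]]; exists y.+1 => z Az lt; apply: contraT => ndz.
have leNz : N <= z by apply: leq_trans leN (ltnW lt).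
have := @same_valuation M y z (HN _ Ay leN) (HN _ Az leNz) nd ndz.
have ey := mono1 Ay; have ez := mono1 Az; have eyz := mono2 Ay Az lt.
have e b c : colouring b = col -> colouring c = col ->
    (dig (val3 b) b == 1) = (dig (val3 c) c == 1).
  by move=> <- [].
by move=> H; case: H; apply: e.
Qed.

Lemma pick_dvd M N : exists y, [/\ A y, N <= y, 0 < y & 3 ^ M %| y].
Proof.
have [N' HN'] := eventually_dvd M.
have [y [ley Ay]] := infA (maxn N'.+1 N); exists y.
by rewrite geq_max in ley; case/andP: ley => l1 l2; split=> //; [lia | apply/HN'/ltnW].
Qed.

(** * Guessing members of the set *)

Variables (R : nat -> nat -> nat -> nat -> bool) (e : nat).
Hypothesis sigA : forall x, A x <-> exists a, forall b, exists c, R x a b c.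
Hypothesis univR : forall x a b,
  (forall c, R x a b c -> exists t0, forall t, t0 <= t -> accepts e x a b t) /\
  (forall t, accepts e x a b t -> exists c, R x a b c).

(** What [plausible] approximates: the same conditions with unbounded quantifiers. *)
Definition good p := forall k, k < 2 ^ e ->
  [/\ 0 < elt k p, log3 (elt k p) < log3 (elt k.+1 p)
    & forall b, exists c, R (elt k p) (wit k p) b c].

Lemma log3_mono x y : 0 < x -> 3 * x <= y -> log3 x < log3 y.
Proof.
move=> x0 le; have /andP [lx _] := log3_spec x0.
have y0 : 0 < y by lia.
have /andP [_ ly] := log3_spec y0.
rewrite -ltnS -(@ltn_exp2l 3) //; apply: leq_ltn_trans ly.
by rewrite expnS; lia.
Qed.

Lemma good_exists : exists p, good p.
Proof.
have [f Hf] : exists s : seq nat, size s = (2 ^ e).+1 /\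
    forall k, k < 2 ^ e -> let x := p1 (nth 0 s k) in
      [/\ 0 < x, log3 x < log3 (p1 (nth 0 s k.+1))
        & forall b, exists c, R x (p2 (nth 0 s k)) b c].
  (* Growth is stated against the predecessor to suit an induction that appends entries. The extra
     entry at [2 ^ e] is what the last proposed element is compared with. *)
  suff [s Hs] : exists s : seq nat, size s = (2 ^ e).+1 /\
      (forall k, k < (2 ^ e).+1 -> let x := p1 (nth 0 s k) in
        [/\ 0 < x, (0 < k -> log3 (p1 (nth 0 s k.-1)) < log3 x)
        & forall b, exists c, R x (p2 (nth 0 s k)) b c]).
    case: Hs => ss Hs; exists s; split=> // k ltk /=.
    case: (Hs k (ltnW ltk)) => x0 _ H; split=> //.
    by case: (Hs k.+1 ltk) => _ /(_ isT).
  elim: (2 ^ e).+1 => [|n [s [ss Hs]]]; first by exists [::].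
  have [x [lex Ax]] := infA (3 * p1 (last 0 s)).+1.
  have [a Ha] := (sigA x).1 Ax.
  exists (rcons s (pr x a)); rewrite size_rcons ss; split=> // k.
  rewrite ltnS leq_eqVlt => /predU1P [->|ltk] /=; last first.
    case: (Hs k ltk) => x0 H1 H2; rewrite !nth_rcons ss ltk.
    by have -> : k.-1 < n by [lia]; split.
  rewrite !nth_rcons ss ltnn eqxx p1_pr p2_pr; split=> //; first by lia.
  move=> n0; have lt1 : n.-1 < n by lia.
  rewrite lt1; case: (Hs n.-1 lt1) => y0 _ _; apply: log3_mono => //.
  by rewrite -ss nth_last; lia.
case: Hf => sf Hf; exists (encl f) => k ltk.
by rewrite /elt /wit !lnth_encl; apply: Hf.
Qed.

Lemma good_plausible p b : good p -> exists t0, forall t, t0 <= t -> plausible e p b t.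
Proof.
move=> gp.
have H k : k < 2 ^ e ->
    exists t0, forall t, t0 <= t -> all (fun i => accepts e (elt k p) (wit k p) i t) (iota 0 b).
  move=> /gp [_ _ Hc]; elim: b => [|b [t0 Ht0]]; first by exists 0.
  have [c /(univR _ _ _).1 [t1 Ht1]] := Hc b.
  exists (maxn t0 t1) => t; rewrite geq_max => /andP [l0 l1].
  by rewrite iota0S all_cat Ht0 //= Ht1.
have H' n : n <= 2 ^ e -> exists t0, forall t, t0 <= t -> forall k, k < n ->
    all (fun i => accepts e (elt k p) (wit k p) i t) (iota 0 b).
  elim: n => [|n IHn] le; first by exists 0.
  have [t0 Ht0] := IHn (ltnW le); have [t1 Ht1] := H n le.
  exists (maxn t0 t1) => t; rewrite geq_max => /andP [l0 l1] k.
  by rewrite ltnS leq_eqVlt => /predU1P [->|ltk]; [apply: Ht1 | apply: Ht0].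
have [t0 Ht0] := H' _ (leqnn _); exists t0 => t le.
apply/allP => k; rewrite mem_iota add0n => /= ltk; rewrite Ht0 // andbT.
by case: (gp k ltk) => -> ->.
Qed.

(** The bound is uniform in [t]: were [p] plausible for arbitrarily large [b], at whatever times,
    each instance of the universal quantifier would have a true witness. *)
Lemma not_good_not_plausible p : ~ good p -> exists b0, forall b t, b0 <= b -> ~~ plausible e p b t.
Proof.
move=> ngp; apply: NNPP => no; apply: ngp => k ltk.
have pl_b b0 : exists b t, b0 <= b /\ plausible e p b t.
  apply: NNPP => nb; apply: no; exists b0 => b t le; apply/negP => o.
  by apply: nb; exists b, t.
have pl_k b t : plausible e p b t -> (0 < elt k p) && (log3 (elt k p) < log3 (elt k.+1 p)) &&
    all (fun i => accepts e (elt k p) (wit k p) i t) (iota 0 b).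
  by move/allP/(_ k); rewrite mem_iota; apply.
split.
- by have [b [t [_ /pl_k /andP [/andP []]]]] := pl_b 0.
- by have [b [t [_ /pl_k /andP [/andP []]]]] := pl_b 0.
move=> b; have [b' [t [lt /pl_k /andP [_ /allP /(_ b)]]]] := pl_b b.+1.
by rewrite mem_iota => /(_ lt) /(univR _ _ _).2.
Qed.

(** A guess is the least plausible code. Each of the finitely many codes below the least good one is
    refuted from some bound on. *)
Lemma least_good : exists p, good p /\ exists b0, forall q b t,
  q < p -> b0 <= b -> ~~ plausible e q b t.
Proof.
have [p gp] := good_exists.
have {p gp} [p [gp minp]] : exists p, good p /\ forall q, q < p -> ~ good q.
  elim/ltn_ind: p gp => p IHp gp.
  case: (classic (exists q, q < p /\ good q)) => [[q [ltq gq]]|none].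
    exact: IHp ltq gq.
  by exists p; split=> // q ltq gq; apply: none; exists q.
exists p; split=> // {gp}.
elim: p minp => [|p IHp] minp; first by exists 0.
have [|b0 H0] := IHp; first by move=> q ltq; apply: minp; apply: ltnW.
have [b1 H1] := not_good_not_plausible (minp p (leqnn _)).
exists (maxn b0 b1) => q b t; rewrite geq_max ltnS leq_eqVlt => /predU1P [->|ltq] /andP [l0 l1].
  exact: H1.
exact: H0.
Qed.

(** Requirements below [e] occupy at most [1 + 2 + ... + 2 ^ (e - 1) < 2 ^ e] leading positions,
    while [p] offers [2 ^ e] distinct ones. *)
Lemma unclaimed p u : (forall k, k < 2 ^ e -> log3 (elt k p) < log3 (elt k.+1 p)) ->
  exists2 k, k < 2 ^ e & forall e', e' < e -> 2 ^ e' <= slot e' (log3 (elt k p)) u.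
Proof.
move=> mono; apply: NNPP => no.
pose L := flatten [seq [seq log3 (elt k (guess i u)) | k <- iota 0 (2 ^ i)] | i <- iota 0 e].
have sizeL : size L < 2 ^ e.
  rewrite /L; elim: (e) => // n IHn.
  rewrite iota0S map_cat flatten_cat size_cat /= cats0 size_map size_iota.
  by rewrite expnS; lia.
have lt_tops k k' : k < k' -> k' <= 2 ^ e -> log3 (elt k p) < log3 (elt k' p).
  elim: k' => // k' IH; rewrite ltnS leq_eqVlt => /predU1P [->|lt] le; first exact: mono.
  by apply: ltn_trans (IH lt (ltnW le)) (mono _ le).
have uniqT : uniq [seq log3 (elt k p) | k <- iota 0 (2 ^ e)].
  rewrite map_inj_in_uniq ?iota_uniq // => k k'; rewrite !mem_iota !add0n => /= lk lk' eqt.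
  case: (ltngtP k k') => // lt.
    by have := lt_tops _ _ lt (ltnW lk'); rewrite eqt ltnn.
  by have := lt_tops _ _ lt (ltnW lk); rewrite eqt ltnn.
have subTL : {subset [seq log3 (elt k p) | k <- iota 0 (2 ^ e)] <= L}.
  move=> j /mapP [k]; rewrite mem_iota add0n => /= ltk ->.
  apply: NNPP => notin; apply: no; exists k => // e' lte'.
  rewrite leqNgt; apply/negP => lts; apply: notin.
  apply/flatten_mapP; exists e'; first by rewrite mem_iota.
  by apply/mapP; exists (slot e' (log3 (elt k p)) u); rewrite ?mem_iota ?log3_slot.
have := uniq_leq_size uniqT subTL; rewrite size_map size_iota.
by rewrite leqNgt sizeL.
Qed.

Lemma no_solution : False.
Proof.
have [p [gp [b0 Hb0]]] := least_good.
have tops k : k < 2 ^ e -> log3 (elt k p) < log3 (elt k.+1 p) by case/gp.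
have [m Hm] : exists m, forall k, k < 2 ^ e -> log3 (elt k p) < m.
  elim: (2 ^ e) => [|n [m Hm]]; first by exists 0.
  exists (maxn m (log3 (elt n p)).+1) => k; rewrite ltnS leq_eqVlt leq_max.
  by case/predU1P => [->|/Hm ->] //; rewrite ltnS leqnn orbT.
(* [m] puts the proposed elements below the nonzero digits of [y]; [b0] makes the valuation of [y]
   large enough to reject every code below [p]. *)
have [y [Ay _ y0 dvdy]] := pick_dvd (maxn m b0) 0.
have valy := val3_ge y0 dvdy.
have [t0 Ht0] := good_plausible (val3 y) gp.
(* [t0] depends on the valuation of [y], so [z] is chosen afterwards: large enough for [u] to exceed
   [t0], [p] and [e], and divisible enough for [u] to keep that valuation. *)
have [z [Az lez z0 dvdz]] := pick_dvd y.+1 (y + t0 + p + e).+1.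
pose u := y + z.
have valu : val3 u = val3 y.
  have [d nd] := val3_spec y0.
  have lt : (val3 y).+1 <= y.+1.
    by rewrite ltnS; apply: leq_trans (ltnW (lt_exp3 _)) (dvdn_leq y0 d).
  have dz : 3 ^ (val3 y).+1 %| z by apply: dvdn_trans dvdz; apply: dvdn_exp2l.
  apply: val3_uniq; last by rewrite /u dvdn_addl.
  by rewrite /u dvdn_add // (dvdn_trans _ dz) // dvdn_exp2l.
have guess_u : guess e u = p.
  apply: find_iota; first by rewrite /u; lia.
    by rewrite valu Ht0 // /u; lia.
  move=> q ltq; apply: Hb0 => //; rewrite valu.
  by apply: leq_trans valy; apply: leq_maxr.
have [k ltk Hk] := unclaimed u tops.
set j := log3 (elt k p) in Hk.
have lts : slot e j u < 2 ^ e.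
  by rewrite -[X in _ < X](size_iota 0) -has_find; apply/hasP; exists k;
    rewrite ?mem_iota ?guess_u /=.
have cu : claimant j u = e.
  apply: find_iota => //; first by rewrite /u; lia.
  by move=> i lti; rewrite -leqNgt Hk.
have cltu : claimant j u < u by rewrite cu /u; lia.
set x := target j u; have tx : log3 x = j by apply: log3_target.
have xE : x = elt (slot e j u) p by rewrite /x /target cu guess_u.
have [x0 _ Rx] := gp _ lts; rewrite -xE in x0 Rx.
have Ax : A x by apply/sigA; exists (wit (slot e j u) p).
have ltjm : j < m by apply: Hm.
have dvd3 n : 3 ^ (maxn m b0) %| n -> 3 ^ j.+1 %| n.
  by apply: dvdn_trans; apply: dvdn_exp2l; rewrite leq_max ltjm.
have dvdu : 3 ^ j.+1 %| u.
  apply: dvdn_add; first exact: dvd3.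
  apply: dvdn_trans dvdz; apply: dvdn_exp2l.
  have := dvdn_leq y0 (dvd3 _ dvdy); have := lt_exp3 j.+1; lia.
have ltxy : x < y.
  by apply: leq_trans (lt_exp_log3 x) _; rewrite tx; apply: dvdn_leq y0 (dvd3 _ dvdy).
have ltyz : y < z by lia.
have u0 : 0 < u by rewrite /u; lia.
(* The sums [x + y + z] and [y + z] share the colour [col], yet their parities differ. *)
have := @parity_target x u x0 u0; rewrite tx => /(_ dvdu cltu erefl).
have := mono3 Ax Ay Az ltxy ltyz; rewrite -(mono2 Ay Az ltyz) -/u => -[_ ->].
by case: (parity u).
Qed.

End Diagonal.

Theorem theorem4p2 :
  exists c : nat -> colour3,
    recursive_coloring c /\
    forall A : nat -> Prop, infinite_set A -> Delta03 A -> ~ HT_solution 3 c A.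
Proof.
exists colouring; split; first exact: colouring_recursive.
move=> A infA [[R [recR sigA]] _] [_ [col monoA]].
have [e univR] := universal recR.
exact: (no_solution infA monoA sigA univR).
Qed.
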